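(* Let $C\subseteq V$, $D\subseteq W$ be closed convex cones in finite-dimensional real vector spaces, with $D$ sharp. Let further $U\subseteq V$ be a subspace that intersects the interior of $C$. Then $\Psi\in\mathrm{Pos}(C\cap U,D)\subseteq\mathrm{Lin}(U,W)$ has an extension to an element of $\mathrm{Pos}(C,D)\subseteq\mathrm{Lin}(V,W)$ if and only if $\Psi\otimes\mathrm{id}_{W'}$ maps $(C\mathbin{\underline{\otimes}}D^\vee)\cap(U\otimes W')$ into $D\mathbin{\underline{\otimes}}D^\vee$. In case $W=\mathbb R$ and $D=\mathbb R_{\geqslant 0}$, this condition holds for every positive functional $\Psi\in\mathrm{Pos}(C\cap U,\mathbb R_{\geqslant 0})$.
   Context: $V'=\mathrm{Lin}(V,\mathbb R)$; $\mathrm{Lin}$ denotes linear maps. For convex cones $C\subseteq V$, $D\subseteq W$: $\mathrm{Pos}(C,D)=\{\Phi\in\mathrm{Lin}(V,W)\mid\Phi(C)\subseteq D\}$; $C\cap U$ is regarded as a cone in $U$. $D^\vee=\{\varphi\in W'\mid\varphi(x)\ge 0\ \forall x\in D\}$. $C\mathbin{\underline{\otimes}}D=\{\sum_i c_i\otimes d_i\mid c_i\in C,d_i\in D\}\subseteq V\otimes W$ (finite sums). $D$ is sharp if $D\cap -D=\{0\}$. *)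

(* Defs.v *)
From HB Require Import structures.
From mathcomp Require Import all_boot all_order all_algebra.
From mathcomp Require Import all_classical all_reals all_analysis.

Set Implicit Arguments.
Unset Strict Implicit.
Unset Printing Implicit Defensive.

Import Order.TTheory GRing.Theory Num.Theory.
Import numFieldNormedType.Exports.
Import VectorInternalTheory.

Local Open Scope classical_set_scope.
Local Open Scope ring_scope.

(* A [vectType R] carries no topology in the library.  A finite-dimensional    *)
(* real vector space has a unique Hausdorff vector space topology; we          *)
(* transport it from ['rV[R]_(dim V)] along the coordinate isomorphism         *)
(* [v2r : V -> 'rV[R]_(dim V)], with inverse [r2v].                            *)
Definition vclosed (R : realType) (V : vectType R) (C : set V) : Prop :=
  closed (r2v @^-1` C : set 'rV[R]_(dim V)).

Definition vinterior (R : realType) (V : vectType R) (C : set V) : set V :=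
  v2r @^-1` interior (r2v @^-1` C : set 'rV[R]_(dim V)).

(* Nonemptiness and the case [a = b = 0] make a convex cone contain the origin. *)
Definition convex_cone (R : realType) (V : vectType R) (C : set V) : Prop :=
  C !=set0 /\
  forall (a b : R) (x y : V),
    0 <= a -> 0 <= b -> C x -> C y -> C (a *: x + b *: y).

Definition sharp (R : realType) (V : vectType R) (C : set V) : Prop :=
  C `&` [set - x | x in C] = [set 0].

Definition Pos (R : realType) (V W : vectType R) (C : set V) (D : set W) :
  set 'Hom(V, W) := [set Phi | Phi @` C `<=` D].

Definition dual_cone (R : realType) (W : vectType R) (D : set W) :
  set 'Hom(W, R^o) := [set phi | forall x, D x -> 0 <= (phi x : R)].

Definition nonneg_cone (R : realType) : set R^o := [set x | 0 <= (x : R)].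
Arguments nonneg_cone R _ : clear implicits.

(* C cap U, as a subset of the vector space U. *)
Definition cone_cap (R : realType) (V : vectType R) (C : set V)
  (U : {vspace V}) : set (subvs_of U) := vsval @^-1` C.
Arguments cone_cap {R V} C U _.

(* The tensor product of V and W, realized as the space of matrices indexed by *)
(* the coordinates of V and of W; see [tensor_universal] below.                *)
Definition tensor (R : realType) (V W : vectType R) : vectType R :=
  'M[R]_(dim V, dim W).

Definition tmul (R : realType) (V W : vectType R) (v : V) (w : W) :
  tensor V W := (v2r v)^T *m v2r w.

(* The linear map f (x) g; see [tmap_tmul] below. *)
Definition tmap (R : realType) (V1 V2 W1 W2 : vectType R)
    (f : 'Hom(V1, V2)) (g : 'Hom(W1, W2)) :
  'Hom(tensor V1 W1, tensor V2 W2) :=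
  linfun (fun A : 'M[R]_(dim V1, dim W1) =>
            (f2mx f)^T *m A *m f2mx g : 'M[R]_(dim V2, dim W2)).

Definition tensor_cone (R : realType) (V W : vectType R)
    (C : set V) (D : set W) : set (tensor V W) :=
  [set t | exists (n : nat) (c : 'I_n -> V) (d : 'I_n -> W),
    (forall i, C (c i) /\ D (d i)) /\ t = \sum_(i < n) tmul (c i) (d i)].

(* X cap (U (x) W), as a subset of the vector space U (x) W, which embeds in   *)
(* V (x) W by [tmap (linfun vsval) \1]; see [tmap_vsval_inj] below.            *)
Definition tensor_cap (R : realType) (V W : vectType R)
    (X : set (tensor V W)) (U : {vspace V}) : set (tensor (subvs_of U) W) :=
  tmap (linfun vsval) \1%VF @^-1` X.
Arguments tensor_cap {R V W} X U _.

Lemma tmapE (R : realType) (V1 V2 W1 W2 : vectType R)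
    (f : 'Hom(V1, V2)) (g : 'Hom(W1, W2)) (A : 'M[R]_(dim V1, dim W1)) :
  tmap f g A = (f2mx f)^T *m A *m f2mx g.
Proof.
pose h := mulmxr (f2mx g) \o mulmx (f2mx f)^T :
  {linear 'M[R]_(dim V1, dim W1) -> 'M[R]_(dim V2, dim W2)}.
exact: (lfunE h A).
Qed.

Lemma lfun_v2r (R : realType) (V W : vectType R) (f : 'Hom(V, W)) v :
  v2r (f v) = v2r v *m f2mx f.
Proof. by rewrite unlock /= r2vK. Qed.

Lemma tmap_tmul (R : realType) (V1 V2 W1 W2 : vectType R)
    (f : 'Hom(V1, V2)) (g : 'Hom(W1, W2)) (v : V1) (w : W1) :
  tmap f g (tmul v w) = tmul (f v) (g w).
Proof. by rewrite tmapE /tmul !lfun_v2r trmx_mul !mulmxA. Qed.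

Lemma tensor_delta (R : realType) (V W : vectType R)
    (A : 'M[R]_(dim V, dim W)) :
  A = \sum_i \sum_j
        A i j *: tmul (r2v (delta_mx 0 i) : V) (r2v (delta_mx 0 j) : W).
Proof.
rewrite {1}[A]matrix_sum_delta; apply: eq_bigr => i _; apply: eq_bigr => j _.
by rewrite /tmul !r2vK trmx_delta mul_delta_mx.
Qed.

Lemma tensor_ext (R : realType) (V W Z : vectType R)
    (f g : 'Hom(tensor V W, Z)) :
  (forall v w, f (tmul v w) = g (tmul v w)) -> f = g.
Proof.
move=> fg; apply/lfunP => A; rewrite [A]tensor_delta !linear_sum.
apply: eq_bigr => i _; rewrite !linear_sum; apply: eq_bigr => j _.
by rewrite !linearZ; congr (_ *: _); exact: fg.
Qed.

Lemma tensor_universal (R : realType) (V W Z : vectType R) (b : V -> W -> Z) :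
  (forall v, linear (b v)) -> (forall w, linear (b^~ w)) ->
  exists! f : 'Hom(tensor V W, Z), forall v w, f (tmul v w) = b v w.
Proof.
move=> linr linl.
pose F (A : 'M[R]_(dim V, dim W)) : Z :=
  \sum_i \sum_j A i j *: b (r2v (delta_mx 0 i)) (r2v (delta_mx 0 j)).
have Flin : linear F.
  move=> a A B; rewrite /F scaler_sumr -big_split; apply: eq_bigr => i _ /=.
  rewrite scaler_sumr -big_split; apply: eq_bigr => j _ /=.
  by rewrite !mxE scalerDl scalerA.
pose FL := GRing.isLinear.Build _ _ _ _ F Flin.
pose Fl : {linear 'M[R]_(dim V, dim W) -> Z} := HB.pack F FL.
have b_suml w n (k : 'I_n -> R) (x : 'I_n -> V) :
    b (\sum_i k i *: x i) w = \sum_i k i *: b (x i) w.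
  pose L := GRing.isLinear.Build _ _ _ _ (b^~ w) (linl w).
  pose l : {linear V -> Z} := HB.pack (b^~ w) L.
  rewrite -[LHS]/(l _) linear_sum; apply: eq_bigr => i _; exact: (linearZ_LR l).
have b_sumr v n (k : 'I_n -> R) (x : 'I_n -> W) :
    b v (\sum_i k i *: x i) = \sum_i k i *: b v (x i).
  pose L := GRing.isLinear.Build _ _ _ _ (b v) (linr v).
  pose l : {linear W -> Z} := HB.pack (b v) L.
  rewrite -[LHS]/(l _) linear_sum; apply: eq_bigr => i _; exact: (linearZ_LR l).
have r2v_sum (T : vectType R) (x : T) :
    x = \sum_i v2r x 0 i *: r2v (delta_mx 0 i).
  rewrite -{1}[x]v2rK {1}[v2r x]row_sum_delta linear_sum.
  by apply: eq_bigr => i _; rewrite linearZ.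
have FE v w : (linfun Fl : 'Hom(tensor V W, Z)) (tmul v w) = b v w.
  rewrite lfunE /= [in RHS](r2v_sum V v) b_suml; apply: eq_bigr => i _.
  rewrite [in RHS](r2v_sum W w) b_sumr scaler_sumr; apply: eq_bigr => j _.
  by rewrite scalerA mxE big_ord1 !mxE.
exists (linfun Fl); split => // g gE.
by apply: tensor_ext => v w; rewrite gE FE.
Qed.

Lemma tmap_vsval_inj (R : realType) (V W : vectType R) (U : {vspace V}) :
  injective (tmap (linfun (@vsval _ V U)) (\1%VF : 'End(W))).
Proof.
pose p := tmap (linfun (vsproj U)) (\1%VF : 'End(W)).
apply: (can_inj (g := p)) => A; rewrite -comp_lfunE -[RHS]id_lfunE.
congr (fun_of_lfun _ _); apply: tensor_ext => v w.
by rewrite comp_lfunE !tmap_tmul !id_lfunE !lfunE /= vsvalK.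
Qed.

(* Main.v *)
From HB Require Import structures.
Require Import Defs.
From mathcomp Require Import all_boot all_order all_algebra.
From mathcomp Require Import all_classical all_reals all_analysis.
From mathcomp Require Import ring.

(** Write W' for the dual of W and D^v for the dual cone of D.  A linear map
    Phi : V -> W is the same thing as a linear functional on V (x) W', namely
    v (x) phi |-> phi (Phi v), and by the bipolar theorem Phi maps C into D if
    and only if this functional is nonnegative on the cone generated by the
    tensors c (x) phi with c in C and phi in D^v.  So extending Psi to a positive
    map on V amounts to extending the functional u (x) phi |-> phi (Psi u) from
    U (x) W' to a functional on V (x) W' that is nonnegative on this cone.  The
    hypothesis on Psi (x) id makes the given functional nonnegative on the part
    of the cone that lies in U (x) W', because evaluation W (x) W' -> R is
    nonnegative on the tensors d (x) phi.  The extension then exists by the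
    theorem of M. Riesz ([riesz_extension]), which asks that U (x) W' contain an
    order unit, that is an algebraic interior point, of the cone.  Such a point
    is u (x) e, with u in U interior to C and e interior to D^v
    ([tensor_order_unit]); e exists because D is sharp ([dual_order_unit]).

    The bipolar theorem is deduced from the same extension theorem: if x is not
    in the closed cone D, then D can be fattened to a cone that still does not
    contain x and that has - x as an order unit, and the functional on the line
    through x with value - 1 at x extends to one that is nonnegative on D
    ([closed_cone_separation]).

    Conversely, if Phi extends Psi, then Psi (x) id is the restriction of
    Phi (x) id, which maps c (x) phi to Phi c (x) phi.  For W = R, Riesz's theorem
    applied to C itself extends every positive functional on U, so that the
    condition always holds. *)

Set Implicit Arguments.
Unset Strict Implicit.
Unset Printing Implicit Defensive.

Import Order.TTheory GRing.Theory Num.Theory.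
Import numFieldNormedType.Exports.
Import VectorInternalTheory.

Local Open Scope classical_set_scope.
Local Open Scope ring_scope.

(** * Extension of positive functionals *)

Lemma linear_lfun (R : realType) (V W : vectType R) (F : V -> W) :
  linear F -> exists f : 'Hom(V, W), forall x, f x = F x.
Proof.
move=> Flin; pose FL := GRing.isLinear.Build _ _ _ _ F Flin.
pose Fl : {linear V -> W} := HB.pack F FL.
by exists (linfun Fl) => x; rewrite lfunE.
Qed.

Section Cones.
Variables (R : realType) (E : vectType R).
Implicit Types (K : set E) (S : {vspace E}) (f g : 'Hom(E, R^o)).

Lemma cone_add K x y : convex_cone K -> K x -> K y -> K (x + y).
Proof.
by move=> [_ cK] Kx Ky; have := cK 1 1 x y ler01 ler01 Kx Ky; rewrite !scale1r.
Qed.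

Lemma cone_scale K a x : convex_cone K -> 0 <= a -> K x -> K (a *: x).
Proof.
move=> [_ cK] a0 Kx; have := cK a 0 x x a0 (lexx _) Kx Kx.
by rewrite scale0r addr0.
Qed.

Lemma cone0 K : convex_cone K -> K 0.
Proof.
by move=> cK; have [[x Kx] _] := cK; rewrite -(scale0r x); exact: cone_scale.
Qed.

Lemma cone_sum K n (x : 'I_n -> E) :
  convex_cone K -> (forall i, K (x i)) -> K (\sum_i x i).
Proof.
move=> cK Kx; apply: (big_ind K) => //; first exact: cone0.
by move=> *; exact: cone_add.
Qed.

Lemma lfunR_scale f a x : f (a *: x) = a * (f x : R).
Proof. exact: linearZ. Qed.

(** Projecting along [S] onto a complement leaves a nonzero vector, one of
    whose coordinates is nonzero. *)
Lemma exists_separating_functional S x : x \notin S ->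
  exists h : 'Hom(E, R^o), (forall s, s \in S -> h s = 0) /\ h x = 1.
Proof.
move=> xS; pose p := daddv_pi (S^C)%VS S.
have capS : (S^C :&: S)%VS = 0%VS by rewrite capvC capv_compl.
have sumS : (S + S^C)%VS = fullv by rewrite addv_complf.
have pS s : s \in S -> p s = 0.
  move=> sS; have := daddv_pi_add capS (w := s).
  rewrite addvC sumS memvf => /(_ isT).
  have -> : daddv_pi S (S^C)%VS s = s by apply: daddv_pi_id; rewrite // capvC.
  by move/eqP; rewrite -subr_eq0 addrK => /eqP.
have px0 : p x != 0.
  apply: contra xS => /eqP px; have := daddv_pi_add capS (w := x).
  by rewrite addvC sumS memvf -/p px add0r => /(_ isT) <-; exact: memv_pi.
have [j pj] : exists j, v2r (p x) 0 j != 0.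
  apply/existsP; apply: contraNT px0 => /existsPn H.
  apply/eqP/(can_inj v2rK); rewrite linear0; apply/rowP => j; rewrite mxE.
  by apply/eqP; move: (H j); rewrite negbK.
have [h hE] : exists h : 'Hom(E, R^o),
    forall y, h y = (v2r (p x) 0 j)^-1 * v2r (p y) 0 j.
  apply: linear_lfun => a y z; rewrite !linearP !mxE mulrDr mulrCA.
  by rewrite -[_ *: _]/(_ * _).
exists h; split=> [s sS|]; rewrite hE.
  by rewrite (pS s)// linear0 mxE mulr0.
by rewrite mulVf.
Qed.

(** An algebraic interior point of [K]: the form of interiority that the
    extension theorem uses. *)
Definition order_unit K e := forall x, exists2 r : R, 0 <= r & K (x + r *: e).

(** The value c of the extension at [x] must satisfy - f s <= c <= f s' whenever
    s + x and s' - x lie in [K].  As s + s' is then in [K], the lower bounds do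
    not exceed the upper ones; the order unit makes both sets nonempty, so that
    the supremum of the lower bounds will do. *)
Lemma riesz_extension_step K e S f x : convex_cone K -> order_unit K e ->
  e \in S -> (forall s, s \in S -> K s -> 0 <= (f s : R)) -> x \notin S ->
  exists g : 'Hom(E, R^o), (forall s, s \in S -> g s = f s) /\
    forall y, y \in (S + <[x]>)%VS -> K y -> 0 <= (g y : R).
Proof.
move=> cK eK eS fS xS.
have [h [hS hx]] := exists_separating_functional xS.
pose A : set R := [set - (f s : R) | s in [set s | s \in S /\ K (s + x)]].
have bnd s s' : s \in S -> s' \in S -> K (s + x) -> K (s' - x) ->
    - (f s : R) <= f s'.
  move=> sS s'S Ks Ks'; have := cone_add cK Ks Ks'.
  rewrite addrACA subrr addr0 => /(fS _ (rpredD sS s'S)).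
  by rewrite linearD => fss; rewrite -subr_ge0 opprK addrC.
have [r r0 Kr] := eK x; have [r' r'0 Kr'] := eK (- x).
have reS t : t *: e \in S by exact: rpredZ.
have A0 : A !=set0.
  by exists (- f (r *: e)), (r *: e) => //; split; rewrite // addrC.
have Aub s' : s' \in S -> K (s' - x) -> ubound A (f s').
  by move=> s'S Ks' _ [s [sS Ks] <-]; exact: bnd.
have supA : has_sup A.
  by split=> //; exists (f (r' *: e)); apply: Aub; rewrite // addrC.
pose c : R := sup A.
have cle s' : s' \in S -> K (s' - x) -> c <= f s'.
  by move=> s'S Ks'; apply: ge_sup => //; exact: Aub.
have cge s : s \in S -> K (s + x) -> - (f s : R) <= c.
  by move=> sS Ks; apply: sup_upper_bound => //; exists s.
(* [h] vanishes on [S] and is 1 at [x]: this is [f] on [S] and [c] at [x]. *)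
pose g := (f + (c - (f x : R)) *: h)%R.
have gE y : g y = (f y : R) + (c - (f x : R)) * (h y : R).
  by rewrite /g add_lfunE scale_lfunE.
exists g; split=> [s sS|y].
  by rewrite gE hS// mulr0 addr0.
move=> /memv_addP[s sS] [_ /vlineP[a ->] ->] Ky.
have -> : g (s + a *: x) = (f s : R) + a * c.
  by rewrite gE !linearD /= !lfunR_scale hS// hx; ring.
case: (ltgtP a 0) => a0.
- have b0 : 0 < - a^-1 by rewrite oppr_gt0 invr_lt0.
  have := cone_scale cK (ltW b0) Ky.
  rewrite scalerDr scalerA mulNr mulVf ?lt_eqF//.
  rewrite scaleN1r => /cle; rewrite rpredZ// => /(_ isT).
  rewrite lfunR_scale -(ler_nM2l a0) mulrA mulrN divff ?lt_eqF// mulN1r.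
  by rewrite -subr_ge0 opprK addrC.
- have b0 : 0 < a^-1 by rewrite invr_gt0.
  have := cone_scale cK (ltW b0) Ky; rewrite scalerDr scalerA mulVf ?gt_eqF//.
  rewrite scale1r => /cge; rewrite rpredZ// => /(_ isT).
  rewrite lfunR_scale -(ler_pM2l a0) mulrN mulrA divff ?gt_eqF// mul1r.
  by rewrite -subr_ge0 opprK addrC.
- by move: Ky; rewrite a0 scale0r addr0 mul0r addr0 => /fS; apply.
Qed.

(** Finite dimension reduces the theorem of M. Riesz to finitely many
    one-dimensional extensions, by induction on the codimension of [S]. *)
Lemma riesz_extension K e S f : convex_cone K -> order_unit K e ->
  e \in S -> (forall s, s \in S -> K s -> 0 <= (f s : R)) ->
  exists g : 'Hom(E, R^o), (forall s, s \in S -> g s = f s) /\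
    forall y, K y -> 0 <= (g y : R).
Proof.
move=> cK eK; have [n] := ubnP (\dim {:E} - \dim S)%N.
elim: n S f => // n IHn S f; rewrite ltnS => dimS eS fS.
have [/eqP SE|] := boolP (S == fullv).
  by exists f; split=> // y; apply: fS; rewrite SE memvf.
move=> /negP SE; have /existsNP[x xS] : ~ forall x, x \in S.
  move=> H; apply: SE; rewrite eqEsubv subvf; apply/subvP => y _; exact: H.
have /negP {}xS := xS.
have [g [gS gK]] := riesz_extension_step cK eK eS fS xS.
have dlt : (\dim S < \dim (S + <[x]>))%N.
  rewrite (ltn_leqif (dimv_leqif_sup (addvSl S <[x]>))).
  by apply: contra xS => /subvP; apply; rewrite memvE addvSr.
have [||k [kS kK]] := IHn (S + <[x]>)%VS g _ _ gK.
- apply: leq_trans dimS; apply: ltn_sub2l => //.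
  by apply: (leq_trans dlt); rewrite dimvS// subvf.
- by rewrite memvE; apply: (subv_trans _ (addvSl _ _)); rewrite -memvE.
exists k; split=> // s sS; rewrite kS ?gS// memvE.
by apply: (subv_trans _ (addvSl _ _)); rewrite -memvE.
Qed.

End Cones.

(** * Closed convex cones and their duals *)

Section Duality.
Variables (R : realType) (W : vectType R).
Implicit Types (D : set W).

(** Turns the topological hypotheses, on interior points of a cone and on points
    outside a closed one, into a norm estimate that can be rescaled. *)
Lemma nbhs_coord_ball (A : set W) (x : W) :
  nbhs (v2r x : 'rV[R]_(dim W)) (r2v @^-1` A : set 'rV[R]_(dim W)) ->
  exists2 e : R, 0 < e & forall z : W, `|v2r z| <= e -> A (x + z).
Proof.
move=> /nbhs_normP[e /= e0 eA]; exists (e / 2); first by rewrite divr_gt0.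
move=> z ze; rewrite -[x + z]v2rK; apply: eA => /=.
rewrite linearD opprD addNKr normrN; apply: le_lt_trans ze _.
by rewrite ltr_pdivrMr// ltr_pMr// ltr1n.
Qed.

Lemma interior_order_unit D u :
  convex_cone D -> vinterior D u -> order_unit D u.
Proof.
move=> cD /nbhs_coord_ball[e e0 eD] x; set t := `|v2r x|.
have t0 : 0 <= t by exact: normr_ge0.
exists (t / e); first by rewrite divr_ge0// ltW.
case: (eqVneq t 0) => [tE|tN0].
  have -> : x = 0.
    by apply/(can_inj v2rK)/eqP; rewrite linear0 -normr_eq0; apply/eqP.
  by rewrite tE mul0r scale0r addr0; exact: cone0.
have -> : x + (t / e) *: u = (t / e) *: (u + (e / t) *: x).
  by rewrite scalerDr scalerA mulrA divfK ?gt_eqF// divff// scale1r addrC.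
apply: cone_scale; rewrite // ?divr_ge0 ?(ltW e0)//.
apply: eD; rewrite linearZ normrZ ger0_norm ?divr_ge0 ?(ltW e0)//.
by rewrite -/t divfK.
Qed.

(** The vectors y such that y + l x is within distance l e of [D] for some l >= 0
    form a convex cone K that contains [D] and has - x as an order unit.  If
    the ball of radius e around [x] misses [D], then K contains no positive
    multiple of [x], so the functional on the line through [x] with value - 1 at
    [x] is nonnegative on K, and Riesz's theorem extends it. *)
Lemma closed_cone_separation D x : convex_cone D -> vclosed D -> ~ D x ->
  exists2 phi : 'Hom(W, R^o), dual_cone D phi & (phi x : R) < 0.
Proof.
move=> cD clD Dx.
have [e e0 eD] : exists2 e : R, 0 < e &
    forall z : W, `|v2r z| <= e -> (~` D) (x + z).
  apply: nbhs_coord_ball; apply: open_nbhs_nbhs; split.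
    by rewrite preimage_setC; exact: closed_openC.
  by rewrite /= v2rK.
pose K : set W := [set y | exists2 l : R, 0 <= l &
  exists2 z, `|v2r z| <= l * e & D (y + l *: x + z)].
have cK : convex_cone K.
  split.
    exists 0, 0 => //; exists 0; first by rewrite linear0 normr0 mul0r.
    by rewrite scale0r !addr0; exact: cone0.
  move=> a b y y' a0 b0 [l l0 [z zl Dz]] [l' l'0 [z' zl' Dz']].
  exists (a * l + b * l'); first by rewrite addr_ge0// mulr_ge0.
  exists (a *: z + b *: z').
    rewrite linearD !linearZ; apply: le_trans (ler_normD _ _) _.
    rewrite !normrZ !ger0_norm// mulrDl -!mulrA.
    by rewrite lerD// ler_wpM2l.
  have := cone_add cD (cone_scale cD a0 Dz) (cone_scale cD b0 Dz').
  congr D; rewrite !scalerDr !scalerDl !scalerA.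
  by rewrite addrACA (addrACA (a *: y)).
have DK y : D y -> K y.
  move=> Dy; exists 0 => //; exists 0; first by rewrite linear0 normr0 mul0r.
  by rewrite scale0r !addr0.
have uK : order_unit K (- x).
  move=> y; set t := `|v2r y|.
  have t0 : 0 <= t / e by rewrite divr_ge0 ?normr_ge0// ltW.
  exists (t / e) => //; exists (t / e) => //; exists (- y).
    by rewrite linearN normrN divfK ?gt_eqF.
  by rewrite scalerN addrNK subrr; exact: cone0.
have x0 : x \notin (0%VS : {vspace W}).
  by rewrite memv0; apply/eqP => xE; apply: Dx; rewrite xE; exact: cone0.
have [h [_ hx]] := exists_separating_functional x0.
have [|s /vlineP[a ->] Ks|g [gS gK]] :=
    @riesz_extension _ _ K (- x) <[x]>%VS (- h) cK uK.
- by rewrite memvN memv_line.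
- rewrite opp_lfunE lfunR_scale hx mulr1 oppr_ge0 leNgt; apply/negP => a0.
  (* a x in K gives a point of D within l e / (a + l) <= e of x *)
  case: Ks => l l0 [z zl Dz].
  have al : 0 < a + l by rewrite ltr_pwDl.
  apply: (eD ((a + l)^-1 *: z)).
    rewrite linearZ normrZ ger0_norm ?invr_ge0 ?(ltW al)// mulrC ler_pdivrMr//.
    by apply: le_trans zl _; rewrite mulrC ler_wpM2l// ?ltW// ltrDr.
  have := cone_scale cD (ltW (etrans (invr_gt0 _) al)) Dz.
  by rewrite -scalerDl scalerDr scalerA mulVf ?gt_eqF// scale1r.
exists g; first by move=> y /DK/gK.
by rewrite gS ?memv_line// opp_lfunE hx ltrN10.
Qed.

Lemma bipolar D x : convex_cone D -> vclosed D ->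
  (forall phi : 'Hom(W, R^o), dual_cone D phi -> 0 <= (phi x : R)) -> D x.
Proof.
move=> cD clD H; apply: contrapT => /(closed_cone_separation cD clD)[phi Dphi].
by rewrite ltNge H.
Qed.

(** By the bipolar theorem the difference of two such points, and its opposite,
    lie in [D]: this is where sharpness enters. *)
Lemma dual_separates_points D x y : convex_cone D -> vclosed D -> sharp D ->
  (forall phi : 'Hom(W, R^o), dual_cone D phi -> phi x = phi y) -> x = y.
Proof.
move=> cD clD sD H; apply/eqP; rewrite -subr_eq0; apply/eqP.
suff : (D `&` [set - z | z in D]) (x - y) by rewrite sD.
split; first by apply: bipolar => // phi /H pE; rewrite linearB /= pE subrr.
exists (y - x); last by rewrite opprB.
by apply: bipolar => // phi /H pE; rewrite linearB /= pE subrr.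
Qed.

Lemma dual_cone_convex D : convex_cone (dual_cone D).
Proof.
split; first by exists 0 => x _; rewrite lfunE.
move=> a b f g a0 b0 Df Dg x Dx.
by rewrite add_lfunE !scale_lfunE addr_ge0// mulr_ge0 ?Df ?Dg.
Qed.

(** In a family for which the common kernel has minimal dimension, adding one more
    member of the dual cone cannot shrink this kernel.  So all members of the dual
    cone vanish on it, and it is trivial because they separate points. *)
Lemma dual_finite_separating D : convex_cone D -> vclosed D -> sharp D ->
  exists n (phi : 'I_n -> 'Hom(W, R^o)), (forall i, dual_cone D (phi i)) /\
    forall x, (forall i, phi i x = 0) -> x = 0.
Proof.
move=> cD clD sD.
pose P k := exists n (phi : 'I_n -> 'Hom(W, R^o)),
  (forall i, dual_cone D (phi i)) /\ \dim (\bigcap_i lker (phi i))%VS = k.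
have Pex : exists k, `[< P k >].
  exists (\dim (fullv : {vspace W})); apply/asboolP; exists 0, (fun=> 0).
  by split; [case|rewrite big_ord0].
case: (ex_minnP Pex) => k /asboolP[n [phi [Dphi dimk]]] kmin.
exists n, phi; split=> // x phix.
apply: (dual_separates_points cD clD sD) => psi Dpsi.
rewrite linear0; apply/eqP; apply: contraT => psix.
pose N := (\bigcap_i lker (phi i))%VS.
pose phi' i := oapp phi psi (unlift ord0 i).
have capE : (\bigcap_i lker (phi' i))%VS = (lker psi :&: N)%VS.
  rewrite big_ord_recl /phi' unlift_none; congr (_ :&: _)%VS.
  by apply: eq_bigr => i _; rewrite liftK.
have /kmin : `[< P (\dim (lker psi :&: N)) >].
  apply/asboolP; exists n.+1, phi'; rewrite capE; split=> // i; rewrite /phi'.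
  by case: unliftP => [j _|_] /=.
rewrite -dimk leqNgt (ltn_leqif (dimv_leqif_sup (capvSr _ _))).
have xN : x \in N.
  by rewrite memvE; apply/subv_bigcapP => i _; rewrite -memvE memv_ker phix.
by rewrite negbK => /subvP/(_ x xN); rewrite memv_cap memv_ker (negPf psix).
Qed.

(** The sum of functionals phi_i in the dual cone with trivial common kernel is an
    order unit: every functional is a combination of the phi_i, and adding r to
    each of its coefficients makes them nonnegative once r is large. *)
Lemma dual_order_unit D : convex_cone D -> vclosed D -> sharp D ->
  exists2 e, dual_cone D e & order_unit (dual_cone D) e.
Proof.
move=> cD clD sD.
have [n [phi [Dphi phi_inj]]] := dual_finite_separating cD clD sD.
exists (\sum_i phi i); first exact: (cone_sum (dual_cone_convex D)).
move=> psi.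
have [L LE] : exists L : 'Hom(W, 'rV[R]_n),
    forall x, L x = \row_i (phi i x : R).
  by apply: linear_lfun => a x y; apply/rowP => i; rewrite !mxE linearP.
have kerL : lker L == 0%VS.
  rewrite -subv0; apply/subvP => x.
  rewrite memv_ker memv0 LE => /eqP/rowP F0.
  apply/eqP/phi_inj => i; have := F0 i; rewrite !mxE; exact.
(* [L] is injective, so [psi] factors as [psi \o L^-1] after [L]. *)
pose a i : R := psi (L^-1%VF (delta_mx 0 i)).
have psiE x : psi x = \sum_i (phi i x : R) * a i :> R.
  rewrite -{1}(lker0_lfunK kerL x) LE [X in L^-1%VF X]row_sum_delta !linear_sum.
  by apply: eq_bigr => i _; rewrite !linearZ mxE.
pose r := \sum_i `|a i|.
exists r; first by apply: sumr_ge0.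
move=> x Dx; rewrite add_lfunE scale_lfunE sum_lfunE psiE.
rewrite -[_ *: _]/(r * _) mulr_sumr -big_split; apply: sumr_ge0 => i _ /=.
rewrite [r * _]mulrC -mulrDr mulr_ge0//; first exact: Dphi.
rewrite -lerBlDl sub0r (le_trans (ler_norm _))// normrN /r (bigD1 i)//= lerDl.
exact: sumr_ge0.
Qed.

End Duality.

(** * Tensor products of cones *)

Section TensorCones.
Variables (R : realType) (V W : vectType R).
Implicit Types (C : set V) (D : set W).

Lemma tmul_coef (v : V) (w : W) i j :
  (tmul v w : 'M[R]_(dim V, dim W)) i j = v2r v 0 i * v2r w 0 j.
Proof. by rewrite mxE big_ord1 mxE. Qed.

Lemma tmulZl a (v : V) (w : W) : tmul (a *: v) w = a *: tmul v w.
Proof.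
by apply/matrixP => i j; rewrite [RHS]mxE !tmul_coef linearZ mxE mulrA.
Qed.

Lemma tmulZr a (v : V) (w : W) : tmul v (a *: w) = a *: tmul v w.
Proof.
by apply/matrixP => i j; rewrite [RHS]mxE !tmul_coef linearZ mxE mulrCA.
Qed.

Lemma tmulDl (v v' : V) (w : W) : tmul (v + v') w = tmul v w + tmul v' w.
Proof.
by apply/matrixP => i j; rewrite [RHS]mxE !tmul_coef linearD mxE mulrDl.
Qed.

Lemma tmul_sumr (v : V) n (w : 'I_n -> W) :
  tmul v (\sum_i w i) = \sum_i tmul v (w i).
Proof. by rewrite /tmul linear_sum mulmx_sumr. Qed.

Lemma tensor_cone_tmul C D c d : C c -> D d -> tensor_cone C D (tmul c d).
Proof.
move=> Cc Dd; exists 1, (fun=> c), (fun=> d); split=> //.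
by rewrite big_ord1.
Qed.

Lemma tensor_cone_convex C D : convex_cone C -> convex_cone (tensor_cone C D).
Proof.
move=> cC; split.
  by exists 0; exists 0, (fun=> 0), (fun=> 0); split; [case|rewrite big_ord0].
move=> a b s t a0 b0 [m [c [d [cd ->]]]] [n [c' [d' [cd' ->]]]].
exists (m + n)%N.
exists (fun i : 'I_(m + n) =>
  match fintype.split i with inl j => a *: c j | inr j => b *: c' j end).
exists (fun i : 'I_(m + n) =>
  match fintype.split i with inl j => d j | inr j => d' j end).
split=> [i|].
  case: (fintype.split i) => j.
    by have [Cj Dj] := cd j; split=> //; exact: cone_scale.
  by have [Cj Dj] := cd' j; split=> //; exact: cone_scale.
rewrite big_split_ord !scaler_sumr; congr (_ + _); apply: eq_bigr => j _.
  by rewrite (unsplitK (inl j)) tmulZl.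
by rewrite (unsplitK (inr j)) tmulZl.
Qed.

(** The right-hand side is a sum of four elements of the tensor cone as soon as
    s, s', p, q are nonnegative, u and e lie in their cones, and so do the four
    shifted vectors; u and e being order units, such scalars exist. *)
Lemma tmul_shift_expand (u v : V) (e w : W) (s s' p q : R) :
  tmul v w + (s' * p + s * q) *: tmul u e =
  tmul (v + s *: u) (w + s' *: e) + s' *: tmul (- (v + s *: u) + p *: u) e +
  (s *: tmul u (- (w + s' *: e) + q *: e) + (s * s') *: tmul u e).
Proof.
apply/matrixP => i j.
have addE (A B : tensor V W) :
    (A + B : 'M[R]_(dim V, dim W)) i j =
    (A : 'M[R]_(dim V, dim W)) i j + (B : 'M[R]_(dim V, dim W)) i j.
  by rewrite mxE.
have scaleE a (A : tensor V W) :
    (a *: A : 'M[R]_(dim V, dim W)) i j = a * (A : 'M[R]_(dim V, dim W)) i j.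
  by rewrite mxE.
rewrite !(addE, scaleE) !tmul_coef !opprD !linearD !linearN !linearZ /= !mxE.
ring.
Qed.

(** The vectors that a nonnegative multiple of the unit moves into the cone are
    closed under addition, so that elementary tensors suffice. *)
Lemma tensor_order_unit C D u e : convex_cone C ->
  C u -> order_unit C u -> D e -> order_unit D e ->
  order_unit (tensor_cone C D) (tmul u e).
Proof.
move=> cC Cu uC De eD; have cK := tensor_cone_convex D cC.
have tmulP v w : exists2 r : R, 0 <= r &
    tensor_cone C D (tmul v w + r *: tmul u e).
  have [s s0 Cs] := uC v; have [s' s'0 Ds'] := eD w.
  have [p p0 Cp] := uC (- (v + s *: u)).
  have [q q0 Dq] := eD (- (w + s' *: e)).
  exists (s' * p + s * q); first by rewrite addr_ge0// mulr_ge0.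
  have ss0 : 0 <= s * s' by rewrite mulr_ge0.
  rewrite tmul_shift_expand; apply: cone_add (cK) _ _; apply: cone_add (cK) _ _.
  - exact: tensor_cone_tmul.
  - by apply: cone_scale (cK) s'0 _; exact: tensor_cone_tmul.
  - by apply: cone_scale (cK) s0 _; exact: tensor_cone_tmul.
  - by apply: cone_scale (cK) ss0 _; exact: tensor_cone_tmul.
pose O t := exists2 r : R, 0 <= r & tensor_cone C D (t + r *: tmul u e).
have O0 : O 0.
  by exists 0 => //; rewrite scale0r addr0; exact: cone0.
have OD s t : O s -> O t -> O (s + t).
  move=> [r r0 Kr] [r' r'0 Kr']; exists (r + r'); first exact: addr_ge0.
  by rewrite scalerDl addrACA; exact: cone_add.
move=> t; rewrite (tensor_delta t); apply: (big_ind O) => // i _.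
by apply: (big_ind O) => // j _; rewrite -tmulZl; exact: tmulP.
Qed.

End TensorCones.

Section TensorDuality.
Variables (R : realType) (V W : vectType R).

(** The isomorphism Lin(V (x) W', R) = Lin(V, W'') = Lin(V, W): the coordinates of
    [Phi v] are the values of [F] at the tensors of v with the coordinate
    functionals of [W]. *)
Lemma tensor_dual_lfun (F : 'Hom(tensor V 'Hom(W, R^o), R^o)) :
  exists Phi : 'Hom(V, W), forall v (phi : 'Hom(W, R^o)),
    phi (Phi v) = F (tmul v phi).
Proof.
have /choice[eps epsE] : forall j, exists f : 'Hom(W, R^o),
    forall w, f w = v2r w 0 j.
  by move=> j; apply: linear_lfun => a x y; rewrite linearP !mxE.
pose delta j : W := r2v (delta_mx 0 j).
have wE w : w = \sum_j v2r w 0 j *: delta j.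
  rewrite -{1}[w]v2rK {1}[v2r w]row_sum_delta linear_sum.
  by apply: eq_bigr => j _; rewrite linearZ.
have phiE (phi : 'Hom(W, R^o)) : phi = \sum_j phi (delta j) *: eps j.
  apply/lfunP => w; rewrite {1}[w]wE linear_sum sum_lfunE.
  apply: eq_bigr => j _.
  by rewrite linearZ scale_lfunE epsE [LHS]mulrC.
have [Phi PhiE] : exists Phi : 'Hom(V, W),
    forall v, Phi v = \sum_j (F (tmul v (eps j)) : R) *: delta j.
  apply: linear_lfun => a x y; rewrite scaler_sumr -big_split.
  apply: eq_bigr => j _.
  by rewrite tmulDl tmulZl linearP scalerDl scalerA.
exists Phi => v phi; rewrite PhiE {2}[phi]phiE.
rewrite tmul_sumr !linear_sum; apply: eq_bigr => j _.
by rewrite tmulZr !linearZ [LHS]mulrC.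
Qed.

End TensorDuality.

(** * Extension of positive maps *)

Section Extension.
Variables (R : realType) (V : vectType R) (C : set V) (U : {vspace V}).

Lemma extension_maps_tensor_cap (W : vectType R) (D : set W)
    (Psi : 'Hom(subvs_of U, W)) (Phi : 'Hom(V, W)) :
  Pos C D Phi -> (forall u : subvs_of U, Phi (vsval u) = Psi u) ->
  tmap Psi \1%VF @` tensor_cap (tensor_cone C (dual_cone D)) U
    `<=` tensor_cone D (dual_cone D).
Proof.
move=> PhiCD PhiE _ [t [n [c [d [cd tE]]]] <-].
have -> : tmap Psi \1%VF t = tmap Phi \1%VF (tmap (linfun vsval) \1%VF t).
  rewrite -[RHS]comp_lfunE; congr (fun_of_lfun _ _); apply: tensor_ext => u w.
  by rewrite comp_lfunE !tmap_tmul !lfunE /= PhiE.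
exists n, (Phi \o c), d; split.
  by move=> i; have [Ci Di] := cd i; split=> //; apply: PhiCD; exists (c i).
rewrite tE linear_sum; apply: eq_bigr => i _.
by rewrite /= tmap_tmul id_lfunE.
Qed.

Lemma evaluation_lfun (W : vectType R) :
  exists ev : 'Hom(tensor W 'Hom(W, R^o), R^o),
    forall w phi, ev (tmul w phi) = phi w.
Proof.
have [||ev [evE _]] :=
  @tensor_universal R W 'Hom(W, R^o) R^o (fun w phi => phi w).
- by move=> w a f g; rewrite add_lfunE scale_lfunE.
- by move=> f a x y; rewrite linearP.
by exists ev.
Qed.

(** The functional u (x) phi |-> phi (Psi u) on U (x) W' extends, by Riesz's theorem,
    to one that is nonnegative on the tensor cone, and the latter comes from a
    linear map V -> W. *)
Lemma positive_extension (W : vectType R) (D : set W)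
    (Psi : 'Hom(subvs_of U, W)) (u : subvs_of U) :
  convex_cone C -> C (vsval u) -> order_unit C (vsval u) ->
  convex_cone D -> vclosed D -> sharp D ->
  tmap Psi \1%VF @` tensor_cap (tensor_cone C (dual_cone D)) U
    `<=` tensor_cone D (dual_cone D) ->
  exists Phi : 'Hom(V, W),
    Pos C D Phi /\ forall u : subvs_of U, Phi (vsval u) = Psi u.
Proof.
move=> cC Cu uC cD clD sD PsiP.
have [e De eD] := dual_order_unit cD clD sD.
have [ev evE] := evaluation_lfun W.
pose K := tensor_cone C (dual_cone D).
have uK := tensor_order_unit cC Cu uC De eD.
pose J := tmap (linfun (@vsval _ V U)) (\1%VF : 'End('Hom(W, R^o))).
(* Riesz's theorem takes a functional on all of V (x) W'; precomposing with a
   projection V -> U provides one with the right values on U (x) W'. *)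
pose f := (ev \o tmap (Psi \o linfun (vsproj U)) \1)%VF.
have fJ t : f (J t) = ev (tmap Psi \1%VF t).
  rewrite comp_lfunE; congr (ev _).
  rewrite -comp_lfunE; congr (fun_of_lfun _ _).
  apply: tensor_ext => v w.
  by rewrite comp_lfunE !tmap_tmul comp_lfunE !lfunE /= vsvalK.
have ev_ge0 s : tensor_cone D (dual_cone D) s -> 0 <= (ev s : R).
  move=> [n [c [d [cd ->]]]]; rewrite linear_sum; apply: sumr_ge0 => i _.
  by have [Di Ei] := cd i; rewrite /= evE; exact: Ei.
have JE v phi : J (tmul v phi) = tmul (vsval v) phi.
  by rewrite /J tmap_tmul id_lfunE lfunE.
have [||g [gJ gK]] := @riesz_extension _ _ K (tmul (vsval u) e) (limg J) f
  (tensor_cone_convex _ cC) uK.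
- by rewrite -JE memv_img// memvf.
- move=> _ /memv_imgP[t _ ->] Kt; rewrite fJ; apply/ev_ge0/PsiP.
  by exists t.
have [Phi PhiE] := tensor_dual_lfun g.
exists Phi; split=> [_ [c Cc <-]|v].
  apply: bipolar => // phi Dphi; rewrite PhiE; apply: gK.
  exact: tensor_cone_tmul.
apply: (dual_separates_points cD clD sD) => phi _.
rewrite PhiE -JE gJ ?memv_img ?memvf//.
by rewrite fJ tmap_tmul evE id_lfunE.
Qed.

Lemma positive_functional_extension (Psi : 'Hom(subvs_of U, R^o))
    (u : subvs_of U) :
  convex_cone C -> order_unit C (vsval u) ->
  Pos (cone_cap C U) (nonneg_cone R) Psi ->
  exists Phi : 'Hom(V, R^o),
    Pos C (nonneg_cone R) Phi /\ forall u : subvs_of U, Phi (vsval u) = Psi u.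
Proof.
move=> cC uC PsiP; pose f := (Psi \o linfun (vsproj U))%VF.
have fE v : f (vsval v) = Psi v by rewrite comp_lfunE lfunE /= vsvalK.
have [||g [gU gC]] := @riesz_extension _ _ C (vsval u) U f cC uC.
- exact: subvsP.
- move=> s sU Cs; rewrite -(vsprojK sU) fE; apply: PsiP.
  by exists (vsproj U s) => //; rewrite /cone_cap /= vsprojK.
exists g; split=> [_ [c Cc <-]|v]; first exact: gC.
by rewrite gU ?fE ?subvsP.
Qed.

End Extension.

Theorem corollary4p2 (R : realType) (V : vectType R) (C : set V)
    (U : {vspace V}) :
  convex_cone C -> vclosed C -> (exists2 u, u \in U & vinterior C u) ->
  (forall (W : vectType R) (D : set W),
     convex_cone D -> vclosed D -> sharp D ->
     forall Psi : 'Hom(subvs_of U, W), Pos (cone_cap C U) D Psi ->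
       (exists Phi : 'Hom(V, W),
          Pos C D Phi /\ forall u : subvs_of U, Phi (vsval u) = Psi u) <->
       tmap Psi \1%VF @` tensor_cap (tensor_cone C (dual_cone D)) U
         `<=` tensor_cone D (dual_cone D)) /\
  (forall Psi : 'Hom(subvs_of U, R^o), Pos (cone_cap C U) (nonneg_cone R) Psi ->
     tmap Psi \1%VF @` tensor_cap (tensor_cone C (dual_cone (nonneg_cone R))) U
       `<=` tensor_cone (nonneg_cone R) (dual_cone (nonneg_cone R))).
Proof.
move=> cC _ [u0 u0U int_u0].
pose u := vsproj U u0; have uE : vsval u = u0 by exact: vsprojK.
have Cu : C (vsval u).
  by rewrite uE -[u0]v2rK; exact: interior_subset int_u0.
have uC : order_unit C (vsval u) by rewrite uE; exact: interior_order_unit.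
split=> [W D cD clD sD Psi _|Psi PsiP].
  split=> [[Phi [PhiP PhiE]]|]; first exact: extension_maps_tensor_cap PhiE.
  exact: positive_extension uC cD clD sD.
have [Phi [PhiP PhiE]] := positive_functional_extension cC uC PsiP.
exact: extension_maps_tensor_cap PhiE.
Qed.
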